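(* Let $n\ge1$, $l\ge1$ be integers, $m_1,\dots,m_l\ge2$ distinct integers, $\alpha_1,\dots,\alpha_l\in\mathbb{R}$, $p\in(0,1)$, and $$f(X)=n\left(\sum_{q=1}^{l}\frac{\alpha_q}{n^{m_q}}\sum_{i_1\neq\dots\neq i_{m_q}}X_{i_1}\cdots X_{i_{m_q}}\right)+\log\left(\frac{p}{1-p}\right)\|X\|_1,\qquad X\in\{0,1\}^n.$$ Let $$J_\alpha=\frac14\sum_{q=1}^{l}|\alpha_q|m_q(m_q-1),$$ and let $\Phi:[0,1]^n\to[0,1]^n$, $\Phi(X)=\frac{\mathbf{1}_n+\tanh(\nabla f(X))}{2}$. If $J_\alpha<1$, then the constant solution $X_c=x\mathbf{1}_n$ (where $x\in(0,1)$ satisfies $x=\varphi_\alpha(x)$) is the only solution in $[0,1]^n$ to the fixed point equation $X=\Phi(X)$, and for any $X\in\mathcal{X}_f$, $$\|X-X_c\|_1\le\frac{5000\,C_\alpha^2}{1-J_\alpha}\,n^{7/8}.$$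
   Context: Sums over $i_1\neq\dots\neq i_m$ run over all ordered $m$-tuples of pairwise distinct indices in $[n]=\{1,\dots,n\}$. $\|\cdot\|_1$ is the $1$-norm on $\mathbb{R}^n$, $\mathbf{1}_n$ is the all-ones vector, and $\tanh$ is applied entrywise. Discrete gradient: $\nabla f(X)=(\partial_1 f(X),\dots,\partial_n f(X))$, where for $X\in\{0,1\}^n$, $\partial_j f(X)=\frac12\big(f(X_1,\dots,X_{j-1},1,X_{j+1},\dots,X_n)-f(X_1,\dots,X_{j-1},0,X_{j+1},\dots,X_n)\big)$; for $X\in[0,1]^n$ it is extended by the formula $$\partial_j f(X)=\frac12\log\left(\frac{p}{1-p}\right)+\sum_{q=1}^{l}\frac{m_q\alpha_q}{2n^{m_q-1}}C_j^{m_q}(X),\qquad C_j^{m}(X)=\sum_{j\neq i_1\neq\dots\neq i_{m-1}}X_{i_1}\cdots X_{i_{m-1}},$$ the last sum being over ordered tuples of pairwise distinct indices all different from $j$. Constants, sets and functions: $$C_\alpha=\max\left\{2,\ \frac12\left|\log\left(\frac{p}{1-p}\right)\right|+\frac12\sum_{q=1}^{l}|\alpha_q|m_q(m_q-1)\right\},$$ $$\mathcal{X}_f=\left\{X\in[0,1]^n:\ \left\|X-\frac{\mathbf{1}_n+\tanh(\nabla f(X))}{2}\right\|_1\le 5000\,C_\alpha^2\,n^{7/8}\right\},$$ $$\varphi_\alpha(x)=\frac12\left(1+\tanh\left(\frac12\log\left(\frac{p}{1-p}\right)+\frac12\sum_{q=1}^{l}m_q\alpha_q\prod_{i=1}^{m_q-1}\left(1-\frac{i}{n}\right)x^{m_q-1}\right)\right),\quad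 x\in[0,1].$$ *)

(* Defs.v *)
From HB Require Import structures.
From mathcomp Require Import all_boot all_order all_algebra.
From mathcomp Require Import all_classical all_reals all_analysis ring lra.
Set Implicit Arguments.
Unset Strict Implicit.
Unset Printing Implicit Defensive.
Import Order.TTheory GRing.Theory Num.Theory.
Local Open Scope classical_set_scope.
Local Open Scope ring_scope.

Definition tanh (R : realType) (x : R) : R :=
  (expR x - expR (- x)) / (expR x + expR (- x)).

(* The library norm on 'rV[R]_n is the sup norm, hence this definition. *)
Definition l1norm (R : realType) (n : nat) (X : 'rV[R]_n) : R :=
  \sum_(i < n) `|X 0 i|.

Definition unit_cube (R : realType) (n : nat) : set 'rV[R]_n :=
  [set X | forall i, 0 <= X 0 i <= 1].

Definition is_vertex (R : realType) (n : nat) (X : 'rV[R]_n) : bool :=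
  [forall i, (X 0 i == 0) || (X 0 i == 1)].

Definition set_coord (R : realType) (n : nat) (X : 'rV[R]_n) (j : 'I_n) (a : R)
  : 'rV[R]_n := \row_i (if i == j then a else X 0 i).

(* The polynomial formula for f, meaningful on all of R^n; only its values on
   {0,1}^n are used (in [dgrad]). *)
Definition fham (R : realType) (n l : nat) (m : 'I_l -> nat) (alpha : 'I_l -> R)
    (p : R) (X : 'rV[R]_n) : R :=
  n%:R * (\sum_(q < l) alpha q / n%:R ^+ m q *
            \sum_(t : (m q).-tuple 'I_n | uniq t) \prod_(i <- t) X 0 i)
  + ln (p / (1 - p)) * l1norm X.

Definition dgrad (R : realType) (n : nat) (g : 'rV[R]_n -> R) (X : 'rV[R]_n)
    (j : 'I_n) : R :=
  2^-1 * (g (set_coord X j 1) - g (set_coord X j 0)).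

Definition Csum (R : realType) (n m : nat) (j : 'I_n) (X : 'rV[R]_n) : R :=
  \sum_(t : (m.-1).-tuple 'I_n | uniq (j :: t)) \prod_(i <- t) X 0 i.

Definition grad_ext (R : realType) (n l : nat) (m : 'I_l -> nat)
    (alpha : 'I_l -> R) (p : R) (X : 'rV[R]_n) (j : 'I_n) : R :=
  2^-1 * ln (p / (1 - p)) +
  \sum_(q < l) (m q)%:R * alpha q / (2 * n%:R ^+ (m q).-1) * Csum (m q) j X.

(* The two branches agree on {0,1}^n, see [gradE] below. *)
Definition grad (R : realType) (n l : nat) (m : 'I_l -> nat)
    (alpha : 'I_l -> R) (p : R) (X : 'rV[R]_n) : 'rV[R]_n :=
  \row_j (if is_vertex X then dgrad (fham m alpha p) X j
          else grad_ext m alpha p X j).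

Definition Phi (R : realType) (n l : nat) (m : 'I_l -> nat)
    (alpha : 'I_l -> R) (p : R) (X : 'rV[R]_n) : 'rV[R]_n :=
  2^-1 *: (const_mx 1 + map_mx (@tanh R) (grad m alpha p X)).

Definition Jalpha (R : realType) (l : nat) (m : 'I_l -> nat)
    (alpha : 'I_l -> R) : R :=
  4^-1 * \sum_(q < l) `|alpha q| * (m q)%:R * ((m q)%:R - 1).

Definition Calpha (R : realType) (l : nat) (m : 'I_l -> nat)
    (alpha : 'I_l -> R) (p : R) : R :=
  Num.max 2 (2^-1 * `|ln (p / (1 - p))| +
             2^-1 * \sum_(q < l) `|alpha q| * (m q)%:R * ((m q)%:R - 1)).

Definition Xset (R : realType) (n l : nat) (m : 'I_l -> nat)
    (alpha : 'I_l -> R) (p : R) : set 'rV[R]_n :=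
  [set X | unit_cube X /\
    l1norm (X - Phi m alpha p X)
      <= 5000 * Calpha m alpha p ^+ 2 * n%:R `^ (7 / 8)].

Definition phi (R : realType) (n l : nat) (m : 'I_l -> nat)
    (alpha : 'I_l -> R) (p : R) (x : R) : R :=
  2^-1 * (1 + tanh (2^-1 * ln (p / (1 - p)) +
    2^-1 * \sum_(q < l) (m q)%:R * alpha q *
             (\prod_(1 <= i < m q) (1 - i%:R / n%:R)) * x ^+ (m q).-1)).

Lemma l1norm_set_coord (R : realType) (n : nat) (X : 'rV[R]_n) (j : 'I_n)
    (a : R) :
  l1norm (set_coord X j a) = `|a| + \sum_(i < n | i != j) `|X 0 i|.
Proof.
rewrite /l1norm (bigD1 j) //= mxE eqxx; congr (_ + _).
by apply: eq_bigr => i /negbTE ij; rewrite mxE ij.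
Qed.

Lemma prod_set_coord_notin (R : realType) (n : nat) (X : 'rV[R]_n) (j : 'I_n)
    (a : R) (s : seq 'I_n) :
  j \notin s -> \prod_(i <- s) set_coord X j a 0 i = \prod_(i <- s) X 0 i.
Proof.
move=> js; apply: eq_big_seq => i si; rewrite mxE.
by case: eqP => // ij; move: js; rewrite -ij si.
Qed.

Lemma tnth_rotr_k (T : Type) (m : nat) (k : 'I_m.+1) (t : m.+1.-tuple T) :
  tnth [tuple of rotr k t] k = thead t.
Proof.
have km : (k <= m)%N by rewrite -ltnS.
rewrite /thead !(tnth_nth (thead t)) /= /rotr /rot nth_cat size_drop size_tuple.
rewrite subKn ?ltnn ?subnn; last exact: ltnW.
by rewrite nth_take // subn_gt0.
Qed.

Lemma diff_tuple_sum (R : realType) (n m : nat) (X : 'rV[R]_n) (j : 'I_n) :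
  \sum_(t : m.-tuple 'I_n | uniq t) \prod_(i <- t) set_coord X j 1 0 i
  - \sum_(t : m.-tuple 'I_n | uniq t) \prod_(i <- t) set_coord X j 0 0 i
  = m%:R * Csum m j X.
Proof.
pose g (t : seq 'I_n) : R := \prod_(i <- t) set_coord X j 1 0 i.
have step1 (t : m.-tuple 'I_n) : uniq t ->
    g t - \prod_(i <- t) set_coord X j 0 0 i
    = \sum_(k < m | tnth t k == j) g t.
  move=> ut; have [jt|jt] := boolP (j \in t).
    have /tnthP[k jk] := jt.
    rewrite [RHS](big_pred1 k); last first.
      move=> k'; apply/eqP/eqP => [|->//]; rewrite jk.
      by move/(tuple_uniqP _ ut).
    by rewrite (bigD1_seq j jt ut) /= mxE eqxx mul0r subr0.
  rewrite [RHS]big_pred0; last first.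
    by move=> k; case: eqP => // jk; case/negP: jt; rewrite -jk mem_tnth.
  by rewrite /g !prod_set_coord_notin // subrr.
rewrite -sumrB (eq_bigr _ step1) (exchange_big_dep xpredT) //=.
case: m step1 => [|m] _; first by rewrite big_ord0 mul0r.
rewrite mulr_natl -[RHS](_ : \sum_(k < m.+1) Csum m.+1 j X = _); last first.
  by rewrite sumr_const card_ord.
apply: eq_bigr => k _.
rewrite (reindex_onto (fun t : m.+1.-tuple 'I_n => [tuple of rotr k t])
                      (fun t => [tuple of rot k t])); last first.
  by move=> t _; apply: val_inj; rewrite /= rotK.
rewrite (reindex (fun t : m.-tuple 'I_n => cons_tuple j t)); last first.
  exists (fun t => behead_tuple t) => [t _|t]; first exact: val_inj.
  rewrite inE => /andP[/andP[_ tj] _]; apply: val_inj => /=.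
  move: tj; rewrite tnth_rotr_k; case/tupleP: t => x t.
  by rewrite theadE => /eqP ->.
have rK (t : m.+1.-tuple 'I_n) : [tuple of rot k [tuple of rotr k t]] = t.
  by apply: val_inj; rewrite /= rotrK.
apply: eq_big => [t|t]; rewrite tnth_rotr_k theadE rK /=.
  by rewrite rotr_uniq !eqxx !andbT.
rewrite rotr_uniq !eqxx !andbT.
move=> /andP[jt _].
rewrite /g (perm_big (j :: t)); last by rewrite perm_rotr.
by rewrite big_cons mxE eqxx /= mul1r prod_set_coord_notin.
Qed.

Lemma gradE (R : realType) (n l : nat) (m : 'I_l -> nat) (alpha : 'I_l -> R)
    (p : R) (X : 'rV[R]_n) (j : 'I_n) :
  (forall q, (1 < m q)%N) ->
  grad m alpha p X 0 j = grad_ext m alpha p X j.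
Proof.
move=> m_gt1; rewrite mxE; case: ifP => // _.
have n_neq0 : n%:R != 0 :> R.
  by rewrite pnatr_eq0 -lt0n; apply: leq_ltn_trans (ltn_ord j).
rewrite /dgrad /fham /grad_ext !l1norm_set_coord normr1 normr0 add0r.
set S := \sum_(i < n | i != j) `|X 0 i|.
set A1 := \sum_q _; set A0 := \sum_q _.
have -> : 2^-1 * (n%:R * A1 + ln (p / (1 - p)) * (1 + S) -
            (n%:R * A0 + ln (p / (1 - p)) * S))
  = 2^-1 * ln (p / (1 - p)) + 2^-1 * n%:R * (A1 - A0) by ring.
congr (_ + _); rewrite -sumrB mulr_sumr; apply: eq_bigr => q _.
rewrite -mulrBr diff_tuple_sum.
case: (m q) (m_gt1 q) => // k _ /=; rewrite exprS.
have nk_neq0 : n%:R ^+ k != 0 :> R by rewrite expf_neq0.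
by field; rewrite n_neq0 nk_neq0.
Qed.

Lemma tanh_bound (R : realType) (x : R) : -1 <= tanh x <= 1.
Proof.
have a0 := expR_gt0 x; have b0 := expR_gt0 (- x).
have s0 : 0 < expR x + expR (- x) by rewrite addr_gt0.
rewrite /tanh ler_pdivlMr // ler_pdivrMr //.
by apply/andP; split; lra.
Qed.

Lemma Phi_unit_cube (R : realType) (n l : nat) (m : 'I_l -> nat)
    (alpha : 'I_l -> R) (p : R) (X : 'rV[R]_n) :
  unit_cube (Phi m alpha p X).
Proof.
move=> j; rewrite !mxE; set y := (X in tanh X).
by have /andP[? ?] := tanh_bound y; apply/andP; split; lra.
Qed.

(* Main.v *)
Require Import Defs.
From mathcomp Require Import all_boot all_order all_algebra.
From mathcomp Require Import all_classical all_reals all_analysis ring lra.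
Set Implicit Arguments.
Unset Strict Implicit.
Unset Printing Implicit Defensive.
Import Order.TTheory GRing.Theory Num.Theory.
Import numFieldNormedType.Exports.
Local Open Scope classical_set_scope.
Local Open Scope ring_scope.

(** The map [Phi] is a contraction of the cube for the 1-norm, with ratio
    [Jalpha] ([Phi_lipschitz]).  A coordinate of [Phi] is [(1 + tanh y) / 2] at
    the gradient [y], so it moves at most half as much as the gradient does
    ([tanh_lipschitz]).  The gradient is a combination of multilinear sums
    [Csum], and a product of numbers of [0, 1] moves at most as much as the sum
    of its factors ([prod_lipschitz]).  Summed over all coordinates and all
    tuples, each coordinate of [X - Y] is then counted [(m - 1) * n ^ (m - 1)]
    times ([sum_tuple_sum], [Csum_lipschitz]); the power of [n] cancels the
    normalisation of the gradient, and what remains is [Jalpha].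

    On a constant vector all the products in [Csum] are equal, and counting
    them turns [Phi] into the scalar map [phi] ([Phi_const]).  Thus a fixed
    point of [phi], which the intermediate value theorem provides
    ([phi_fixpoint]), gives a constant fixed point [Xc] of [Phi].

    The rest is the stability estimate of a contraction: the triangle inequality
    through [Phi X] gives
    [l1norm (X - Xc) <= l1norm (X - Phi X) + Jalpha * l1norm (X - Xc)],
    hence [l1norm (X - Xc) <= l1norm (X - Phi X) / (1 - Jalpha)].  The right
    side vanishes at a fixed point, which gives uniqueness, and on [Xset] it is
    at most the announced bound. *)

(** * The hyperbolic tangent *)

Lemma expRD_expRN_gt0 (R : realType) (x : R) : 0 < expR x + expR (- x).
Proof. by rewrite addr_gt0 ?expR_gt0. Qed.

Lemma tanh_strict_bound (R : realType) (x : R) : -1 < tanh x < 1.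
Proof.
have a0 := expR_gt0 x; have b0 := expR_gt0 (- x).
rewrite /tanh ltr_pdivlMr ?ltr_pdivrMr ?expRD_expRN_gt0 //.
by apply/andP; split; lra.
Qed.

Lemma is_derive_tanh (R : realType) (x : R) :
  is_derive x 1 (@tanh R) (1 - tanh x ^+ 2).
Proof.
have s_neq0 (y : R) : expR y + expR (- y) != 0.
  by rewrite gt_eqF // expRD_expRN_gt0.
have dN : is_derive x 1 (expR \o -%R : R -> R) (expR (- x) * -1).
  exact: is_derive1_comp.
have dS := is_deriveD (is_derive_expR x) dN.
have dD := is_deriveB (is_derive_expR x) dN.
have dV := @is_deriveV _ (expR + (expR \o -%R)) _ _ _ (s_neq0 x) dS.
have dT := is_deriveM dD dV.
apply: is_derive_eq; rewrite /tanh /= /GRing.scale /=.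
by have := s_neq0 x; rewrite !fctE /= => ?; field.
Qed.

(** By the mean value theorem, as the derivative [1 - tanh ^+ 2] lies in [0, 1]. *)
Lemma tanh_lipschitz (R : realType) (x y : R) :
  `|tanh x - tanh y| <= `|x - y|.
Proof.
wlog lexy : x y / y <= x.
  by move=> H; case: (leP y x) => [/H//|/ltW/H]; rewrite distrC (distrC x).
have [] := @MVT_segment R (@tanh R) (fun z => 1 - tanh z ^+ 2) y x lexy.
- by move=> z _; exact: is_derive_tanh.
- by apply: derivable_within_continuous => z _; have [] := is_derive_tanh z.
move=> c _ ->; rewrite normrM ler_piMl //.
have /andP[? ?] := tanh_bound c; rewrite ger0_norm; nra.
Qed.

Lemma continuous_tanh (R : realType) : continuous (@tanh R).
Proof.
move=> x; apply: differentiable_continuous; apply/derivable1_diffP.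
by have [] := is_derive_tanh x.
Qed.

(** * Products and sums over tuples *)

(** Replace the factors one at a time: each replacement changes the product by
    the change of that factor times numbers of absolute value at most 1. *)
Lemma prod_lipschitz (R : realDomainType) (I : Type) (s : seq I) (F G : I -> R) :
  (forall i, 0 <= F i <= 1) -> (forall i, 0 <= G i <= 1) ->
  `|\prod_(i <- s) F i - \prod_(i <- s) G i| <= \sum_(i <- s) `|F i - G i|.
Proof.
move=> F01 G01; elim: s => [|a s IHs]; first by rewrite !big_nil subrr normr0.
rewrite !big_cons; set f := \prod_(i <- s) F i; set g := \prod_(i <- s) G i.
have -> : F a * f - G a * g = (F a - G a) * f + G a * (f - g) by ring.
apply: le_trans (ler_normD _ _) _; rewrite !normrM; apply: lerD.
  rewrite ler_piMr // ger0_norm.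
    by apply: prodr_ile1 => i _; exact: F01.
  by apply: prodr_ge0 => i _; case/andP: (F01 i).
have /andP[Ga0 Ga1] := G01 a.
by rewrite (le_trans _ IHs) // ler_piMl // ger0_norm.
Qed.

(** At each of the [k] positions of a [k]-tuple, each value occurs in
    [n ^ k.-1] tuples; the factor [n] on the left avoids the predecessor, so
    that the case [k = 0] is not special. *)
Lemma sum_tuple_sum (R : comPzRingType) (n k : nat) (F : 'I_n -> R) :
  n%:R * \sum_(t : k.-tuple 'I_n) \sum_(i <- t) F i
  = k%:R * n%:R ^+ k * \sum_i F i.
Proof.
elim: k => [|k IHk].
  by rewrite big1 ?mulr0 ?mul0r // => t _; rewrite tuple0 big_nil.
rewrite (reindex (fun z : 'I_n * k.-tuple 'I_n => cons_tuple z.1 z.2)) /=;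
    last first.
  exists (fun t => (thead t, behead_tuple t)) => [[x t] _|t _] /=.
    by congr pair; apply: val_inj.
  by rewrite [RHS]tuple_eta; apply: val_inj.
under eq_bigr do rewrite big_cons.
rewrite big_split /= -(pair_bigA _ (fun x (t : k.-tuple 'I_n) => F x)) /=.
rewrite -(pair_bigA _ (fun (x : 'I_n) (t : k.-tuple 'I_n) => \sum_(i <- t) F i)).
rewrite /= sumr_const card_ord -[X in _ + X]mulr_natl IHk.
under eq_bigr do rewrite sumr_const card_tuple card_ord -mulr_natl.
by rewrite -mulr_sumr natrX exprS -natr1; ring.
Qed.

Lemma l1norm_triangle (R : realType) (n : nat) (X Y : 'rV[R]_n) :
  l1norm (X + Y) <= l1norm X + l1norm Y.
Proof.
by rewrite /l1norm -big_split; apply: ler_sum => i _; rewrite mxE ler_normD.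
Qed.

Lemma l1norm0 (R : realType) (n : nat) : l1norm (0 : 'rV[R]_n) = 0.
Proof. by rewrite /l1norm big1 // => i _; rewrite mxE normr0. Qed.

Lemma l1norm_le0 (R : realType) (n : nat) (X : 'rV[R]_n) :
  l1norm X <= 0 -> X = 0.
Proof.
move=> X_le0; apply/rowP => i; rewrite mxE; apply/eqP.
rewrite -normr_le0; apply: le_trans X_le0.
by rewrite /l1norm (bigD1 i) //= lerDl sumr_ge0.
Qed.

(** The distinctness conditions only remove nonnegative terms from the upper
    bound.  Without them the bound is the same for all [j], so that the outer sum
    is the factor [n] of [sum_tuple_sum]. *)
Lemma Csum_lipschitz (R : realType) (n m : nat) (X Y : 'rV[R]_n) :
  unit_cube X -> unit_cube Y ->
  \sum_j `|Csum m j X - Csum m j Y|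
    <= m.-1%:R * n%:R ^+ m.-1 * l1norm (X - Y).
Proof.
move=> X01 Y01; rewrite /l1norm -sum_tuple_sum mulr_natl.
rewrite -[n in _ *+ n]card_ord -sumr_const; apply: ler_sum => j _.
rewrite /Csum -sumrB; apply: le_trans (ler_norm_sum _ _ _) _.
rewrite big_mkcond; apply: ler_sum => t _ /=; case: ifP => _.
  apply: le_trans (prod_lipschitz _ X01 Y01) _.
  by apply: ler_sum => i _; rewrite !mxE.
exact: sumr_ge0.
Qed.

(** If [n <= k], both sides vanish: the product contains the factor with
    [i = n]. *)
Lemma natr_ffact_pred (R : numFieldType) (n k : nat) : (0 < n)%N ->
  (n.-1 ^_ k)%:R
  = n%:R ^+ k * \prod_(1 <= i < k.+1) (1 - i%:R / n%:R) :> R.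
Proof.
move=> n_gt0; have n_neq0 : n%:R != 0 :> R by rewrite pnatr_eq0 -lt0n.
elim: k => [|k IHk]; first by rewrite big_geq // mulr1.
rewrite big_nat_recr //= exprSr mulrACA -IHk.
have [ltnk|lekn] := ltnP n.-1 k.
  by rewrite !ffact_small ?mul0r // ltnW.
rewrite ffactnSr natrM natrB // -[k.+1%:R]natr1.
have -> : n%:R = n.-1%:R + 1 :> R by rewrite natr1 prednK.
field; by rewrite natr1 prednK.
Qed.

(** All terms are equal, and their number is that of the duplicate-free tuples
    avoiding [j], the falling factorial [n.-1 ^_ m.-1]. *)
Lemma Csum_const (R : realType) (n m : nat) (j : 'I_n) (x : R) : (0 < m)%N ->
  Csum m j (const_mx x)
  = n%:R ^+ m.-1 * (\prod_(1 <= i < m) (1 - i%:R / n%:R)) * x ^+ m.-1.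
Proof.
case: m => // k _; have n_gt0 : (0 < n)%N by case: n j => [[]|].
have -> : Csum k.+1 j (const_mx x)
    = \sum_(t : k.-tuple 'I_n | uniq (j :: t)) x ^+ k.
  apply: eq_bigr => t _; under eq_bigr do rewrite mxE.
  by rewrite big_const_seq count_predT size_tuple iter_mulr_1.
rewrite sumr_const -[LHS]mulr_natl; congr (_ * _).
rewrite /= -natr_ffact_pred //; congr _%:R.
have <- : #|predC1 j| = n.-1 by rewrite cardC1 card_ord.
rewrite -card_uniq_tuples cardsE; apply: eq_card => t.
by rewrite unfold_in /= (all_predC (pred1 j)) has_pred1.
Qed.

(** * The contraction *)

(** With [gradE], vertices of the cube no longer need separate treatment. *)
Lemma PhiE (R : realType) (n l : nat) (m : 'I_l -> nat) (alpha : 'I_l -> R)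
    (p : R) (X : 'rV[R]_n) (j : 'I_n) :
  (forall q, (1 < m q)%N) ->
  Phi m alpha p X 0 j = 2^-1 * (1 + tanh (grad_ext m alpha p X j)).
Proof. by move=> m_gt1; rewrite -gradE // !mxE. Qed.

Lemma Phi_const (R : realType) (n l : nat) (m : 'I_l -> nat) (alpha : 'I_l -> R)
    (p x : R) :
  (forall q, (1 < m q)%N) ->
  Phi m alpha p (const_mx x : 'rV_n) = const_mx (phi n m alpha p x).
Proof.
move=> m_gt1; apply/rowP => j; rewrite PhiE // mxE /phi /grad_ext.
have n_neq0 : n%:R != 0 :> R.
  by rewrite pnatr_eq0 -lt0n; apply: leq_ltn_trans (ltn_ord j).
congr (_ * (_ + tanh (_ + _))); rewrite mulr_sumr; apply: eq_bigr => q _.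
rewrite Csum_const; last exact: ltnW.
have nk_neq0 : n%:R ^+ (m q).-1 != 0 :> R by rewrite expf_neq0.
by field.
Qed.

(** The constant [1/4] of [Jalpha] is the [1/2] of [Phi] times the [1/2] of the
    gradient. *)
Lemma Phi_lipschitz (R : realType) (n l : nat) (m : 'I_l -> nat)
    (alpha : 'I_l -> R) (p : R) (X Y : 'rV[R]_n) :
  (forall q, (1 < m q)%N) -> unit_cube X -> unit_cube Y ->
  l1norm (Phi m alpha p X - Phi m alpha p Y)
    <= Jalpha m alpha * l1norm (X - Y).
Proof.
move=> m_gt1 X01 Y01.
(* For [n = 0] the powers of [n] would not cancel, but the norms are 0. *)
case: n X Y X01 Y01 => [|n] X Y X01 Y01.
  by rewrite /l1norm !big_ord0 mulr0.
apply: (@le_trans _ _ (2^-1 * \sum_j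
    \sum_(q < l) (m q)%:R * `|alpha q| / (2 * n.+1%:R ^+ (m q).-1)
                  * `|Csum (m q) j X - Csum (m q) j Y|)).
  rewrite mulr_sumr; apply: ler_sum => j _.
  have -> : (Phi m alpha p X - Phi m alpha p Y) 0 j
      = Phi m alpha p X 0 j - Phi m alpha p Y 0 j by rewrite !mxE.
  rewrite !PhiE // -mulrBr opprD addrACA subrr add0r normrM ger0_norm ?invr_ge0 //.
  rewrite ler_wpM2l ?invr_ge0 //; apply: le_trans (tanh_lipschitz _ _) _.
  rewrite /grad_ext opprD addrACA subrr add0r -sumrB.
  apply: le_trans (ler_norm_sum _ _ _) _; apply: ler_sum => q _.
  by rewrite -mulrBr !normrM normfV normrM normrX !normr_nat.
rewrite exchange_big /= mulr_sumr /Jalpha -mulrA mulr_suml [leRHS]mulr_sumr.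
apply: ler_sum => q _; rewrite -mulr_sumr.
apply: le_trans (_ : 2^-1 * ((m q)%:R * `|alpha q| / (2 * n.+1%:R ^+ (m q).-1) *
  ((m q).-1%:R * n.+1%:R ^+ (m q).-1 * l1norm (X - Y))) <= _).
  by rewrite ler_wpM2l ?invr_ge0 // ler_wpM2l ?Csum_lipschitz //.
have -> : (m q).-1%:R = (m q)%:R - 1 :> R.
  by rewrite -{2}(prednK (ltnW (m_gt1 q))) -natr1 addrK.
have nk_neq0 : n.+1%:R ^+ (m q).-1 != 0 :> R by rewrite expf_neq0.
by rewrite le_eqVlt; apply/orP; left; apply/eqP; field.
Qed.

(** [phi] is continuous with values strictly between 0 and 1, hence
    [phi x - x] is positive at 0 and negative at 1; the bounds on [phi] also put
    the zero in the open interval. *)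
Lemma phi_fixpoint (R : realType) (n l : nat) (m : 'I_l -> nat)
    (alpha : 'I_l -> R) (p : R) :
  exists x : R, 0 < x < 1 /\ x = phi n m alpha p x.
Proof.
have phi01 x : 0 < phi n m alpha p x < 1.
  rewrite /phi; set y := (X in tanh X).
  by have /andP[? ?] := tanh_strict_bound y; apply/andP; split; lra.
have cphi : continuous (phi n m alpha p).
  move=> x; rewrite /phi.
  apply: cvgMl_tmp; apply: cvgD; first exact: cvg_cst.
  apply: continuous_cvg; first exact: continuous_tanh.
  apply: cvgD; first exact: cvg_cst.
  apply: cvgMl_tmp; apply: cvg_big => [|q _]; first exact: add_continuous.
  apply: cvgMl_tmp.
  exact: exprn_continuous.
have [||x _ xE] := @IVT R (fun x => phi n m alpha p x - x) 0 1 0 ler01.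
- apply: continuous_subspaceT => x; apply: cvgB; [exact: cphi|exact: cvg_id].
- have /andP[? _] := phi01 0; have /andP[_ ?] := phi01 1.
  by rewrite ge_min le_max; apply/andP; split; apply/orP; [right|left]; lra.
have {}xE : x = phi n m alpha p x by apply/esym/eqP; rewrite -subr_eq0 xE.
by exists x; split=> //; rewrite xE; exact: phi01.
Qed.

Theorem theorem4p9 (R : realType) (n l : nat) (m : 'I_l -> nat)
    (alpha : 'I_l -> R) (p : R)
    (n_ge1 : (1 <= n)%N) (l_ge1 : (1 <= l)%N)
    (m_ge2 : forall q, (2 <= m q)%N) (m_inj : injective m)
    (p_gt0 : 0 < p) (p_lt1 : p < 1)
    (J_lt1 : Jalpha m alpha < 1) :
  (exists x : R, 0 < x < 1 /\ x = phi n m alpha p x) /\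
  forall x : R, 0 < x < 1 -> x = phi n m alpha p x ->
    (forall X : 'rV[R]_n, unit_cube X ->
       (X = Phi m alpha p X <-> X = const_mx x)) /\
    (forall X : 'rV[R]_n, Xset m alpha p X ->
       l1norm (X - const_mx x)
         <= 5000 * Calpha m alpha p ^+ 2 / (1 - Jalpha m alpha)
            * n%:R `^ (7 / 8)).
Proof.
split; first exact: phi_fixpoint.
move=> x /andP[x_gt0 x_lt1] xE; set Xc : 'rV[R]_n := const_mx x.
have Xc_cube : unit_cube Xc by move=> i; rewrite mxE !ltW.
have XcE : Phi m alpha p Xc = Xc by rewrite Phi_const // -xE.
have J1 : 0 < 1 - Jalpha m alpha by rewrite subr_gt0.
have dist_le X : unit_cube X ->
    l1norm (X - Xc) <= l1norm (X - Phi m alpha p X) / (1 - Jalpha m alpha).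
  move=> X01; rewrite ler_pdivlMr // mulrBr mulr1 lerBlDr [_ * Jalpha _ _]mulrC.
  apply: le_trans (lerD (lexx _) (Phi_lipschitz alpha p m_ge2 X01 Xc_cube)).
  by rewrite XcE -{1}(subrKA (Phi m alpha p X)) l1norm_triangle.
split=> [X X01|X [X01 Xle]]; last first.
  apply: le_trans (dist_le X X01) _.
  by rewrite [leRHS]mulrAC ler_pM2r ?invr_gt0.
split=> [XE|->//].
apply/eqP; rewrite -subr_eq0; apply/eqP/l1norm_le0.
by apply: le_trans (dist_le X X01) _; rewrite -XE subrr l1norm0 mul0r.
Qed.
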